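(* Let $k$ be a positive integer, and let $H$ be the $k$-centipede. If $k<5$, then every minimal $H$-obstruction that is a forest is a linear forest. If $k\ge 5$, then $T_2$ is the only minimal $H$-obstruction that is a forest but not a linear forest.
   Context: Graphs are finite and undirected, with neither loops nor parallel edges. A full homomorphism from $G$ to $H$ (full $H$-colouring of $G$) is a function $\varphi\colon V_G\to V_H$ such that, for all $u,v\in V_G$, $uv\in E_G$ if and only if $\varphi(u)\varphi(v)\in E_H$. A minimal $H$-obstruction is a graph that admits no full homomorphism to $H$ but all of whose proper induced subgraphs do. The $k$-centipede is the tree on $2k$ vertices obtained from a path on $k$ vertices (the spine) by attaching exactly one leaf to every vertex of the path (so the $1$-centipede is the path on two vertices). A linear forest is a graph each of whose components is a path. $T_2$ is the tree obtained from $K_{1,3}$ by subdividing each edge once. Uniqueness is up to isomorphism. *)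

(* Defs.v *)
From mathcomp Require Import all_boot.

Set Implicit Arguments.
Unset Strict Implicit.
Unset Printing Implicit Defensive.

Record sgraph := SGraph {
  vertex :> finType;
  adj : rel vertex;
  adj_sym : symmetric adj;
  adj_irrefl : irreflexive adj }.

Definition full_hom (G H : sgraph) (f : G -> H) : Prop :=
  forall u v : G, adj u v = adj (f u) (f v).

Definition full_colourable (G H : sgraph) : Prop :=
  exists f : G -> H, full_hom f.

Definition isomorphic (G H : sgraph) : Prop :=
  exists2 f : G -> H, bijective f & forall u v : G, adj u v = adj (f u) (f v).

Section Induced.
Variables (G : sgraph) (A : {set G}).
Definition induced_adj : rel {x : G | x \in A} :=
  fun x y => adj (val x) (val y).
Lemma induced_adj_sym : symmetric induced_adj.
Proof. by move=> x y; apply: adj_sym. Qed.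
Lemma induced_adj_irrefl : irreflexive induced_adj.
Proof. by move=> x; apply: adj_irrefl. Qed.
Definition induced : sgraph := SGraph induced_adj_sym induced_adj_irrefl.
End Induced.

Definition minimal_obstruction (H G : sgraph) : Prop :=
  ~ full_colourable G H /\
  forall A : {set G}, A \proper [set: G] -> full_colourable (induced A) H.

Section PathGraph.
Variable n : nat.
Definition path_adj : rel 'I_n :=
  fun i j => (i.+1 == j :> nat) || (j.+1 == i :> nat).
Lemma path_adj_sym : symmetric path_adj.
Proof. by move=> i j; rewrite /path_adj orbC. Qed.
Lemma path_adj_irrefl : irreflexive path_adj.
Proof. by move=> i; rewrite /path_adj orbb eqn_leq ltnn. Qed.
Definition path_graph : sgraph := SGraph path_adj_sym path_adj_irrefl.
End PathGraph.

(* inl x is the original vertex x, inr x is the leaf attached to it. *)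
Section AttachLeaves.
Variable G : sgraph.
Definition attach_adj : rel (G + G)%type := fun x y =>
  match x, y with
  | inl u, inl v => adj u v
  | inl u, inr v | inr u, inl v => u == v
  | inr _, inr _ => false
  end.
Lemma attach_adj_sym : symmetric attach_adj.
Proof. by move=> [u|u] [v|v] //=; rewrite (adj_sym, eq_sym). Qed.
Lemma attach_adj_irrefl : irreflexive attach_adj.
Proof. by move=> [u|u] //=; apply: adj_irrefl. Qed.
Definition attach_leaves : sgraph := SGraph attach_adj_sym attach_adj_irrefl.
End AttachLeaves.

Definition centipede (k : nat) : sgraph := attach_leaves (path_graph k).

Section CompleteBipartite.
Variables m n : nat.
Definition bip_adj : rel ('I_m + 'I_n)%type := fun x y =>
  match x, y with
  | inl _, inr _ | inr _, inl _ => true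
  | _, _ => false
  end.
Lemma bip_adj_sym : symmetric bip_adj.
Proof. by move=> [u|u] [v|v]. Qed.
Lemma bip_adj_irrefl : irreflexive bip_adj.
Proof. by move=> [u|u]. Qed.
Definition complete_bipartite : sgraph := SGraph bip_adj_sym bip_adj_irrefl.
End CompleteBipartite.

Definition edges (G : sgraph) : {set {set G}} :=
  [set [set p.1; p.2] | p : G * G & adj p.1 p.2].

(* Each edge e is replaced by a new vertex inr e joined to the two ends of e. *)
Section Subdivision.
Variable G : sgraph.
Definition subdiv_adj : rel (G + {e : {set G} | e \in edges G})%type :=
  fun x y =>
  match x, y with
  | inl v, inr e | inr e, inl v => v \in val e
  | _, _ => false
  end.
Lemma subdiv_adj_sym : symmetric subdiv_adj.
Proof. by move=> [u|u] [v|v]. Qed.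
Lemma subdiv_adj_irrefl : irreflexive subdiv_adj.
Proof. by move=> [u|u]. Qed.
Definition subdivision : sgraph := SGraph subdiv_adj_sym subdiv_adj_irrefl.
End Subdivision.

Definition T2 : sgraph := subdivision (complete_bipartite 1 3).

(* [ucycle] accepts cycles of length 2 (an edge traversed back and forth),
   hence the size condition. *)
Definition forest (G : sgraph) : Prop :=
  forall c : seq G, 2 < size c -> ~ ucycle (@adj G) c.

Definition component (G : sgraph) (x : G) : {set G} :=
  [set y | connect (@adj G) x y].

Definition linear_forest (G : sgraph) : Prop :=
  forall x : G, exists n : nat,
    isomorphic (induced (component x)) (path_graph n).

(* Main.v *)
Require Import Defs.
From mathcomp Require Import all_boot.
From mathcomp Require Import zify.

Set Implicit Arguments.
Unset Strict Implicit.
Unset Printing Implicit Defensive.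

(** Two vertices with the same neighbourhood (twins) can always be given the
    same colour, so a minimal obstruction [G] has no twins; and a full
    homomorphism defined on a twin-free graph is injective.  Hence the
    question is which twin-free forests are induced subgraphs of the
    centipede.

    Let [G] be a minimal obstruction that is a forest, and suppose that some
    vertex [v] has at least three neighbours.
    - If a neighbour [l] of [v] is a leaf, colour [G - l].  Being twin-free,
      [G] has no second leaf at [v], so [v] keeps two neighbours with further
      neighbours, and these get distinct colours; this forces [v] onto the
      spine, and [l] can take the leaf attached to the colour of [v].  So [G]
      is colourable, a contradiction ([leaf_neighbour_max_degree2]).
    - Otherwise three neighbours of [v] have a further neighbour each, and
      since forests have no cycle of length 3, 4 or 5 these seven vertices
      induce a copy of [T2] ([T2_model_embeds]).

    [T2] has no full homomorphism to any centipede: the images of its centre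
    and of the three middle vertices have two neighbours each, so they lie on
    the spine, which is a path ([T2_model_not_colourable]).  By minimality
    [G] is then [T2].  It remains to decide when [T2] is minimal.  Deleting the
    centre leaves three disjoint edges with no edge between them; each image
    has an end on the spine and these ends are pairwise at distance at least
    two, which takes a spine of five vertices
    ([three_edges_not_colourable]).  Five are also enough, and for any vertex
    deleted ([T2_model_colourable_off]).

    Finally, a forest of maximum degree two is linear: a longest path through
    a vertex exhausts its component and has no chord
    ([linear_forest_of_max_degree2]). *)

(** * Full homomorphisms and minimal obstructions *)

Definition twin_free (G : sgraph) : Prop :=
  forall u v : G, (forall w, adj u w = adj v w) -> u = v.

Lemma full_hom_inj (G H : sgraph) (f : G -> H) :
  twin_free G -> full_hom f -> injective f.
Proof. by move=> tfG ff u v fuv; apply: tfG => w; rewrite !ff fuv. Qed.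

Lemma full_hom_comp (F G H : sgraph) (g : G -> H) (f : F -> G) :
  full_hom g -> full_hom f -> full_hom (g \o f).
Proof. by move=> fg ff u v; rewrite ff fg. Qed.

(** Colourings of induced subgraphs are easier to combine as total functions on
    [G]; the vertex [x] provides the default value. *)
Lemma partial_colouring (G H : sgraph) (A : {set G}) (x : G) :
  x \in A -> full_colourable (induced A) H ->
  exists f : G -> H, {in A &, forall u v, adj u v = adj (f u) (f v)}.
Proof.
move=> xA [f ff]; exists (fun u => f (insubd (exist _ x xA) u)) => u v uA vA.
by rewrite -ff /= /induced_adj !insubdK.
Qed.

Lemma colouring_off (G H : sgraph) (x y : G) :
  minimal_obstruction H G -> x != y ->
  exists f : G -> H,
    forall u v, u != x -> v != x -> adj u v = adj (f u) (f v).
Proof.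
move=> [_ minG] xy; have yA : y \in [set~ x] by rewrite !inE eq_sym.
have pA : [set~ x] \proper [set: G].
  by apply/properP; split; [exact: subsetT | exists x; rewrite ?inE ?eqxx].
have [f ff] := partial_colouring yA (minG _ pA).
by exists f => u v ux vx; apply: ff; rewrite !inE.
Qed.

(** A colouring of [G - v] extends to [G] by giving [v] the colour of its
    twin. *)
Lemma minimal_obstruction_twin_free (G H : sgraph) :
  minimal_obstruction H G -> twin_free G.
Proof.
move=> minG u v tw; apply/eqP; case: eqVneq => // uv; case: (minG) => [ncol _].
have vu : v != u by rewrite eq_sym.
have [f ff] := colouring_off minG vu; case: ncol.
pose r w := if w == v then u else w.
have rv w : r w != v by rewrite /r; case: (eqVneq w v).
have ar w w' : adj (r w) w' = adj w w' by rewrite /r; case: eqVneq => // ->.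
by exists (f \o r) => w w' /=; rewrite -ff // ar [RHS]adj_sym ar adj_sym.
Qed.

(** A vertex missed by [f] could be deleted from [G]; a colouring of the rest
    would then colour [F]. *)
Lemma obstruction_onto (F G H : sgraph) (f : F -> G) (y : G) :
  ~ full_colourable F H -> minimal_obstruction H G ->
  full_hom f -> F -> exists x, f x = y.
Proof.
move=> ncolF minG ff x0; case: (boolP (y \in codom f)) => [/codomP[x ->]|yf].
  by exists x.
have fy x : f x != y by apply: contraNneq yf => <-; apply: codom_f.
have yx0 : y != f x0 by rewrite eq_sym.
have [g fg] := colouring_off minG yx0; case: ncolF.
by exists (g \o f) => u v; rewrite ff fg.
Qed.

Lemma inj_surj_bij (S T : finType) (f : S -> T) :
  injective f -> (forall y, exists x, f x = y) -> bijective f.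
Proof.
move=> injf /fin_all_exists[g gK].
by exists g => // x; apply: injf; rewrite gK.
Qed.

(** * Forests *)

Lemma adj_neq (G : sgraph) (u v : G) : adj u v -> u != v.
Proof. by apply: contraTneq => ->; rewrite adj_irrefl. Qed.

Lemma forest_no_triangle (G : sgraph) (a b c : G) :
  forest G -> adj a b -> adj b c -> adj c a -> False.
Proof.
move=> fG ab bc ca; apply: (fG [:: a; b; c]) => //.
by rewrite /ucycle /= ab bc ca !inE negb_or !adj_neq // adj_sym.
Qed.

(** Two vertices with two common neighbours would lie on a 4-cycle. *)
Lemma forest_common_neighbours (G : sgraph) (u v a b : G) :
  forest G -> a != b -> adj u a -> adj u b -> adj v a -> adj v b -> u = v.
Proof.
move=> fG ab ua ub va vb; apply/eqP; case: eqVneq => // uv.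
have av : adj a v by rewrite adj_sym.
have bu : adj b u by rewrite adj_sym.
case: (fG [:: u; a; v; b]) => //.
by rewrite /ucycle /= ua av vb bu !inE !negb_or uv ab !adj_neq.
Qed.

(** When two of the five vertices coincide, the closed walk contains a
    triangle. *)
Lemma forest_no_pentagon (G : sgraph) (a b c d e : G) :
  forest G -> adj a b -> adj b c -> adj c d -> adj d e -> adj e a -> False.
Proof.
move=> fG ab bc cd de ea; have tri := @forest_no_triangle G _ _ _ fG.
have ac : a != c by apply/eqP => E; subst c; exact: tri cd de ea.
have ad : a != d by apply/eqP => E; subst d; exact: tri ab bc cd.
have bd : b != d by apply/eqP => E; subst d; exact: tri ab de ea.
have be : b != e by apply/eqP => E; subst e; exact: tri bc cd de.
have ce : c != e by apply/eqP => E; subst e; exact: tri ab bc ea.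
apply: (fG [:: a; b; c; d; e]) => //; rewrite /ucycle /= ab bc cd de ea.
by rewrite !inE !negb_or ac ad bd be ce !adj_neq // adj_sym.
Qed.

Lemma forest_embedding (G H : sgraph) (f : G -> H) :
  injective f -> full_hom f -> forest H -> forest G.
Proof.
move=> injf ff fH c c2 /andP[cyc uc]; apply: (fH (map f c)).
  by rewrite size_map.
rewrite /ucycle map_inj_uniq // uc andbT cycle_map.
by rewrite (eq_cycle (e' := @adj G)) // => u v; rewrite /= ff.
Qed.

Lemma cycle_two_neighbours (T : eqType) (e : rel T) (c : seq T) (x : T) :
  symmetric e -> ucycle e c -> 2 < size c -> x \in c ->
  exists y z, [/\ y \in c, z \in c, y != z, e x y & e x z].
Proof.
move=> sym_e cyc c2 /rot_to[i s def_c].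
rewrite -(rot_ucycle i) -(size_rot i) def_c in cyc c2.
have mem_s y : y \in s -> y \in c.
  by rewrite -(mem_rot i c) def_c inE orbC => ->.
(* the neighbours of [x] on the cycle: the first and last vertices of [s] *)
case: s => // y s in def_c cyc c2 mem_s *.
case/lastP: s => // s z in def_c cyc c2 mem_s *.
exists y, z; move: cyc => /andP[/= /andP[xy]].
rewrite !rcons_path last_rcons => /andP[_ zx] /and3P[_ yz _].
split=> //; try by apply: mem_s; rewrite !inE ?mem_rcons ?inE eqxx ?orbT.
  by apply: contraNneq yz => ->; rewrite mem_rcons inE eqxx.
by rewrite sym_e.
Qed.

(** A chord would close a cycle with the segment of the path that it spans. *)
Lemma forest_path_chordless (G : sgraph) (x0 : G) (s : seq G) (i j : nat) :
  forest G -> uniq s -> sorted (@adj G) s -> i < j < size s ->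
  adj (nth x0 s i) (nth x0 s j) = (i.+1 == j).
Proof.
move=> fG us ss /andP[ij js]; case: eqVneq => [j_i|nij].
  by subst j; move/(sortedP x0): ss; apply.
apply/negP => chord; pose c := drop i (take j.+1 s).
have sc : size c = j.+1 - i by rewrite size_drop size_takel.
apply: (fG c); first by lia.
have uc : uniq c by rewrite drop_uniq ?take_uniq.
have srt : sorted (@adj G) c by rewrite drop_sorted ?take_sorted.
have h0 : nth x0 c 0 = nth x0 s i by rewrite nth_drop addn0 nth_take //; lia.
have hl : last x0 c = nth x0 s j.
  by rewrite -nth_last nth_drop nth_take; [congr nth|]; lia.
rewrite /ucycle uc andbT; case: c sc uc srt h0 hl => //= y p _ _ yp y_i hl.
by rewrite rcons_path yp hl y_i adj_sym.
Qed.

Lemma forest_path_adj (G : sgraph) (s : seq G) (u v : G) :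
  forest G -> uniq s -> sorted (@adj G) s -> u \in s -> v \in s ->
  adj u v = ((index u s).+1 == index v s) || ((index v s).+1 == index u s).
Proof.
move=> fG us ss.
wlog: u v / index u s <= index v s => [th uin vin|].
  case/orP: (leq_total (index u s) (index v s)) => le; first exact: th.
  by rewrite adj_sym orbC; apply: th.
rewrite leq_eqVlt => /orP[/eqP eq_i|lt_i] uin vin.
  have -> : u = v by rewrite -(nth_index u uin) eq_i nth_index.
  by rewrite adj_irrefl; lia.
rewrite -{1}(nth_index u uin) -{1}(nth_index u vin).
by rewrite forest_path_chordless ?lt_i ?index_mem //; lia.
Qed.

Lemma longest_path (G : sgraph) (x : G) :
  exists s : seq G, [/\ uniq s, sorted (@adj G) s, x \in s &
    forall t : seq G, uniq t -> sorted (@adj G) t -> x \in t ->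
      size t <= size s].
Proof.
pose P n := [exists s : n.-tuple G, [&& uniq s, sorted (@adj G) s & x \in s]].
have exP : exists n, P n.
  by exists 1; apply/existsP; exists [tuple x]; rewrite /= inE eqxx.
have leP n : P n -> n <= #|G|.
  case/existsP => s /and3P[us _ _].
  by rewrite -(size_tuple s) -(card_uniqP us) max_card.
case: (ex_maxnP exP leP) => n /existsP[s /and3P[us ss xs]] maxn.
exists s; split=> // t ut st xt; rewrite size_tuple; apply: maxn.
by apply/existsP; exists (in_tuple t); rewrite ut st xt.
Qed.

(** An edge leaving a longest path prolongs it when it leaves from an end, and
    gives a vertex of degree three when it leaves from an inner vertex. *)
Lemma longest_path_closed (G : sgraph) (x y z : G) (s : seq G) :
  (forall v : G, #|adj v| <= 2) ->
  uniq s -> sorted (@adj G) s -> x \in s ->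
  (forall t : seq G, uniq t -> sorted (@adj G) t -> x \in t ->
     size t <= size s) ->
  y \in s -> adj y z -> z \in s.
Proof.
move=> deg2 us ss xs maxs ys yz; apply/negPn/negP => zs.
have zy : adj z y by rewrite adj_sym.
case/splitPr: ys => p1 p2 in us ss xs maxs zs *.
case/lastP: p1 => [|p1 a] in us ss xs maxs zs *.
  move: us ss xs maxs zs; rewrite cat0s => us ss xs maxs zs.
  have szs : sorted (@adj G) (z :: y :: p2) by rewrite /= zy.
  have := maxs _ _ szs; rewrite cons_uniq zs us inE xs orbT ltnn.
  by move=> /(_ isT isT).
case: p2 => [|b p2] in us ss xs maxs zs *.
  have := maxs (rcons (rcons p1 a ++ [:: y]) z).
  rewrite size_rcons ltnn rcons_uniq zs us mem_rcons inE xs orbT.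
  rewrite -cats1 -catA sorted_cat_cons -cats1 ss /= yz.
  by move=> /(_ isT isT isT).
suff: 2 < #|adj y| by rewrite ltnNge deg2.
move: ss us zs; rewrite cat_rcons sorted_cat_cons => /and4P[_ ay yb _].
rewrite uniq_catC /= mem_cat inE !negb_or => /andP[/andP[_ /andP[ab _]] _].
rewrite mem_cat !inE !negb_or => /and3P[_ za /and3P[_ zb _]].
apply/card_gt2P; exists a, b, z.
have ya : adj y a by rewrite adj_sym.
by split; split; rewrite // eq_sym.
Qed.

(** By the previous lemma a longest path through [x] fills the component of
    [x]; being chordless it is a path graph, a vertex being sent to its position
    on the path. *)
Lemma linear_forest_of_max_degree2 (G : sgraph) :
  forest G -> (forall v : G, #|adj v| <= 2) -> linear_forest G.
Proof.
move=> fG deg2 x; have [s [us ss xs maxs]] := longest_path x.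
have sym_c : connect_sym (@adj G) := sym_connect_sym (@adj_sym G).
have closed_s : closed (@adj G) (mem s).
  apply: intro_closed => // u v uv us'.
  exact: (longest_path_closed deg2 us ss xs maxs us' uv).
have comp_s y : (y \in component x) = (y \in s).
  rewrite inE; apply/idP/idP => [xy|ys].
    by have := closed_connect closed_s xy; rewrite xs => <-.
  (* [x] and [y] are both connected to the first vertex [a] of the path *)
  case: (s) ss xs ys => // a t pt xt yt.
  apply: (connect_trans (y := a)); last exact: path_connect pt _ yt.
  by rewrite sym_c; apply: path_connect pt _ xt.
exists (size s).
have val_s (u : induced (component x)) : val u \in s.
  by rewrite -comp_s; apply: valP u.
have idx (u : induced (component x)) : index (val u) s < size s.
  by rewrite index_mem.
exists (fun u => Ordinal (idx u)) => [|u v]; last first.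
  exact: (forest_path_adj fG us ss).
have inc (i : 'I_(size s)) : nth x s i \in component x.
  by rewrite comp_s mem_nth.
exists (fun i : path_graph (size s) => exist _ (nth x s i) (inc i)) => [u|i];
  apply: val_inj => /=.
  exact: (nth_index x (val_s u)).
by rewrite index_uniq.
Qed.

Lemma path_graph_no_claw (n : nat) (q : 'I_n) (p : 'I_3 -> 'I_n) :
  injective p -> ~ forall i, path_adj q (p i).
Proof.
move=> injp qp; pose i0 : 'I_3 := ord0; pose i1 := lift ord0 (ord0 : 'I_2).
have d i j : i != j -> (p i != p j :> nat).
  by apply: contraNneq => /val_inj/injp ->.
have := d i0 i1 isT; have := d i0 ord_max isT; have := d i1 ord_max isT.
have := qp i0; have := qp i1; have := qp ord_max; rewrite /path_adj.
lia.
Qed.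

Lemma claw_not_linear (G : sgraph) (v : G) (c : 'I_3 -> G) :
  injective c -> (forall i, adj v (c i)) -> ~ linear_forest G.
Proof.
move=> injc vc lin; case: (lin v) => n [f /bij_inj injf ff].
have vin : v \in component v by rewrite inE connect0.
have cin i : c i \in component v by rewrite inE connect1.
pose c' i : induced (component v) := exist _ (c i) (cin i).
apply: (@path_graph_no_claw _ (f (exist _ v vin)) (f \o c')).
  by move=> i j /injf[/injc].
move=> i; have := vc i.
by rewrite -[adj v _]/(adj (exist _ v vin : induced _) (c' i)) ff.
Qed.

(** * A coordinate model of T2 *)

(** [T2] with its vertices in coordinates, so that adjacency computes: [None]
    is the centre, and the [i]-th leg consists of a neighbour of the centre
    (the knee) and of the leaf attached to it (the foot). *)
Definition T2_model_adj : rel (option ('I_3 * bool)) := fun x y =>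
  match x, y with
  | None, Some (_, b) | Some (_, b), None => ~~ b
  | Some (i, b), Some (j, b') => (i == j) && (b (+) b')
  | None, None => false
  end.

Lemma T2_model_adj_sym : symmetric T2_model_adj.
Proof. by move=> [[i b]|] [[j b']|] //=; rewrite eq_sym addbC. Qed.

Lemma T2_model_adj_irrefl : irreflexive T2_model_adj.
Proof. by move=> [[i b]|] //=; rewrite addbb andbF. Qed.

Definition T2_model : sgraph := SGraph T2_model_adj_sym T2_model_adj_irrefl.

Notation knee i := (Some (i, false) : T2_model).
Notation foot i := (Some (i, true) : T2_model).

Lemma T2_model_twin_free : twin_free T2_model.
Proof.
have far j b : T2_model_adj (Some (j, b)) (knee (lift j ord0)) = false.
  by rewrite /= (negPf (neq_lift _ _)).
move=> [[i b]|] [[j b']|] tw //.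
- have /= /negb_inj-> := tw None; have /= := tw (Some (i, ~~ b)).
  by rewrite eqxx; case: eqP => [->|]; case: (b).
- by have := tw (knee (lift i ord0)); rewrite [LHS]far.
- by have := tw (knee (lift j ord0)); rewrite [RHS]far.
Qed.

Lemma foot_neighbour (i : 'I_3) (x : T2_model) : adj (foot i) x -> x = knee i.
Proof. by case: x => [[j []]|] //= /andP[/eqP->]. Qed.

Lemma knee_neighbour (i : 'I_3) (x : T2_model) :
  adj (knee i) x -> x = foot i \/ x = None.
Proof.
case: x => [[j []]|] //=; last by right.
  by move=> /andP[/eqP->]; left.
by move=> /andP[].
Qed.

(** Every vertex of a cycle has two neighbours on it.  So feet lie on no cycle,
    hence neither do knees, hence neither does the centre. *)
Lemma T2_model_forest : forest T2_model.
Proof.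
move=> c c2 cyc.
have nfoot i : foot i \notin c.
  apply/negP => /(cycle_two_neighbours T2_model_adj_sym cyc c2).
  move=> [y [z [_ _ yz iy iz]]].
  by move: yz; rewrite (foot_neighbour iy) (foot_neighbour iz) eqxx.
have nknee i : knee i \notin c.
  apply/negP => /(cycle_two_neighbours T2_model_adj_sym cyc c2).
  move=> [y [z [yc zc yz /knee_neighbour-iy /knee_neighbour-iz]]].
  case: iy yc yz => ->; first by rewrite (negPf (nfoot i)).
  by case: iz zc => -> zc; rewrite ?eqxx // (negPf (nfoot i)) in zc *.
have ncentre : (None : T2_model) \notin c.
  apply/negP => /(cycle_two_neighbours T2_model_adj_sym cyc c2).
  move=> [y [z [yc _ _ iy _]]].
  by move: yc iy; case: y => [[j []]|] //=; rewrite (negPf (nknee _)).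
case: c c2 cyc nfoot nknee ncentre => // x c _ _ nfoot nknee ncentre.
have: x \in x :: c by rewrite inE eqxx.
by case: x nfoot nknee ncentre => [[i []]|] nf nk nc; apply/negP.
Qed.

Lemma T2_model_isomorphic :
  exists f : T2_model -> T2, bijective f /\ full_hom f.
Proof.
pose K := complete_bipartite 1 3.
pose o : K := inl ord0; pose w i : K := inr i.
have inE3 i : [set o; w i] \in edges K.
  by apply/imsetP; exists (o, w i); rewrite ?inE.
pose f (x : T2_model) : T2 := match x with
  | None => inl o
  | Some (i, true) => inl (w i)
  | Some (i, false) => inr (exist _ [set o; w i] (inE3 i)) end.
have ff : full_hom f.
  by move=> [[i []]|] [[j []]|] //=; rewrite ?inE ?andbF ?andbT.
exists f; split=> //.
have injf := full_hom_inj T2_model_twin_free ff.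
have surjf : forall y, exists x, f x = y.
  case=> [[i|i]|[e eE]].
  - by exists None; rewrite /= /o (ord1 i).
  - by exists (foot i).
  case/imsetP: (eE) => p; rewrite inE; case: p => [[i|i] [j|j]] //= _ E.
    by exists (knee j); congr inr; apply: val_inj; rewrite /= E (ord1 i).
  by exists (knee i); congr inr; apply: val_inj; rewrite /= E (ord1 j) setUC.
exact: inj_surj_bij.
Qed.

(** * Colouring T2 with a centipede *)

(** The other vertices of a centipede are leaves. *)
Lemma spine_of_two_neighbours (k : nat) (x y z : centipede k) :
  adj x y -> adj x z -> y <> z -> exists i, x = inl i.
Proof.
case: x => i; first by exists i.
by case: y => // j /eqP->; case: z => // l /eqP->.
Qed.

Lemma edge_spine (k : nat) (x y : centipede k) :
  adj x y -> exists i, x = inl i \/ y = inl i.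
Proof.
by case: x => [i|i]; [exists i; left | case: y => // j; exists j; right].
Qed.

(** The colours of the centre and of the knees have two neighbours each, so they
    are on the spine, where no vertex has three neighbours. *)
Lemma T2_model_not_colourable (k : nat) :
  ~ full_colourable T2_model (centipede k).
Proof.
move=> [f ff]; have injf := full_hom_inj T2_model_twin_free ff.
have centre_knee i : adj (f None) (f (knee i)) by rewrite -ff.
have knee_centre i : adj (f (knee i)) (f None) by rewrite -ff.
have knee_foot i : adj (f (knee i)) (f (foot i)) by rewrite -ff /= eqxx.
have [q fq] : exists q, f None = inl q.
  apply: spine_of_two_neighbours (centre_knee ord0) (centre_knee ord_max) _.
  by move=> /injf.
have /fin_all_exists[p fp] : forall i : 'I_3, exists j, f (knee i) = inl j.
  move=> i; apply: spine_of_two_neighbours (knee_centre i) (knee_foot i) _.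
  by move=> /injf.
apply: (@path_graph_no_claw k q p) => [i j pij|i].
  by have := injf (knee i) (knee j); rewrite !fp pij => /(_ erefl)[].
by have := centre_knee i; rewrite fq fp.
Qed.

(** Without its centre, [T2] consists of three legs.  Each of them meets the
    spine in some [p i], and the [p i] are pairwise at distance at least two,
    which does not fit into four spine vertices. *)
Lemma three_edges_not_colourable (k : nat) (f : T2_model -> centipede k) :
  k < 5 ->
  ~ forall u v : T2_model, u != None -> v != None -> adj u v = adj (f u) (f v).
Proof.
move=> k5 ff.
have /fin_all_exists[p fp] :
    forall i : 'I_3, exists j : 'I_k, exists b, f (Some (i, b)) = inl j.
  move=> i.
  have := @edge_spine k (f (knee i)) (f (foot i)).
  rewrite -ff //= eqxx => /(_ isT)[j [E|E]]; exists j; last by exists true.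
  by exists false.
have d i j : i != j -> ((p i).+1 < p j) || ((p j).+1 < p i).
  move=> ij; have [b fi] := fp i; have [b' fj] := fp j.
  have nij : path_adj (p i) (p j) = false.
    have := ff (Some (i, b)) (Some (j, b')) isT isT.
    by rewrite fi fj /= (negPf ij).
  (* if [p i = p j], the other end of leg [i] would be adjacent to leg [j] *)
  have pij : p i != p j :> nat.
    apply/eqP => /val_inj E; move: fi; rewrite E -fj => fij.
    have := ff (Some (i, b)) (Some (i, ~~ b)) isT isT.
    by rewrite fij -ff //= eqxx eq_sym (negPf ij); case: (b).
  by move: nij pij; rewrite /path_adj; lia.
pose i0 : 'I_3 := ord0; pose i1 := lift ord0 (ord0 : 'I_2).
have := d i0 i1 isT; have := d i0 ord_max isT; have := d i1 ord_max isT.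
have := ltn_ord (p i0); have := ltn_ord (p i1); have := ltn_ord (p ord_max).
lia.
Qed.

Lemma centipede_widen (k m : nat) :
  k <= m -> exists f : centipede k -> centipede m, full_hom f.
Proof.
move=> km; pose w := widen_ord km.
have eqw i j : (w i == w j) = (i == j) by rewrite -(inj_eq val_inj).
exists (fun x => match x with inl i => inl (w i) | inr i => inr (w i) end).
by move=> [i|i] [j|j] //=; rewrite eqw.
Qed.

(** The colouring of [T2] minus its centre: leg [i] goes to spine vertex [2 * i]
    and its leaf. *)
Definition spread (x : T2_model) : centipede 5 :=
  match x with
  | Some (Ordinal 0 _, b) => (if b then inr else inl) (@Ordinal 5 0 isT)
  | Some (Ordinal 1 _, b) => (if b then inr else inl) (@Ordinal 5 2 isT)
  | Some (_, b) => (if b then inr else inl) (@Ordinal 5 4 isT)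
  | None => inl (@Ordinal 5 1 isT)
  end.

(** The colouring of [T2] minus a vertex of leg [i].  The other two legs and the
    centre, a path on five vertices, go to the path that follows the spine from
    0 to 2 with the leaves of 0 and 2 as its ends.  Knee [i], if
    present, is a leaf at the centre, which has colour 1, and takes the leaf of
    1; foot [i], if present, is isolated and takes the leaf of 3. *)
Definition fold_leg (i : 'I_3) (x : T2_model) : centipede 5 :=
  match x with
  | Some (j, b) =>
      if j == i then inr (if b then @Ordinal 5 3 isT else @Ordinal 5 1 isT)
      else (if b then inr else inl)
             (if j == ordS i then @Ordinal 5 0 isT else @Ordinal 5 2 isT)
  | None => inl (@Ordinal 5 1 isT)
  end.

Lemma T2_model_colourable_off (k : nat) (x : T2_model) :
  5 <= k -> exists f : T2_model -> centipede k,
    forall u v, u != x -> v != x -> adj u v = adj (f u) (f v).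
Proof.
move=> /centipede_widen[g fg].
suff [f ff] : exists f : T2_model -> centipede 5,
    forall u v, u != x -> v != x -> adj u v = adj (f u) (f v).
  by exists (g \o f) => u v ux vx; rewrite ff // fg.
case: x => [[i b]|].
  exists (fold_leg i) => u v.
  case: i => [[|[|[|//]]] hi];
  case: u => [[[[|[|[|//]]] h] []]|];
  case: v => [[[[|[|[|//]]] h'] []]|];
    by case: b.
exists spread => u v.
case: u => [[[[|[|[|//]]] h] []]|]; by case: v => [[[[|[|[|//]]] h'] []]|].
Qed.

(** * Obstructions with a vertex of degree three *)

(** If [v] had two more neighbours [a] and [b], a colouring [f] of [G - l] would
    send [v] to the spine and no other vertex to [f v], so that [l] could take
    the leaf attached to [f v]. *)
Lemma leaf_neighbour_max_degree2 (k : nat) (G : sgraph) (v l : G) :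
  minimal_obstruction (centipede k) G -> forest G ->
  adj v l -> (forall w, adj l w -> w = v) -> #|adj v| <= 2.
Proof.
move=> minG fG vl leaf_l; rewrite leqNgt; apply/negP => deg3.
have tfG := minimal_obstruction_twin_free minG.
have: 1 < #|[predD1 (adj v) & l]|.
  by move: deg3; rewrite (cardD1 l) [l \in _]vl.
move=> /card_gt1P[a [b [/andP[/= al va] /andP[/= bl vb] ab]]].
have lv : l != v by rewrite eq_sym adj_neq.
(* otherwise [a] and [l] would be twins *)
have /exists_inP[a' aa' a'v] : [exists (w | adj a w), w != v].
  rewrite -negb_forall_in; apply: contra al => /forall_inP leaf_a.
  apply/eqP/tfG => w; apply/idP/idP => [aw|lw].
    by have /eqP-> := leaf_a w aw; rewrite adj_sym.
  by rewrite (leaf_l w lw) adj_sym.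
have a'l : a' != l.
  apply: contraTneq aa' => ->; apply/negP; rewrite adj_sym => /leaf_l av.
  by have := adj_neq va; rewrite av eqxx.
have vNl : v != l by rewrite eq_sym.
have [f ff] := colouring_off minG lv.
(* otherwise [b] would be adjacent to [a'], closing the 4-cycle v a a' b *)
have fab : f a <> f b.
  move=> E; case/eqP: a'v; apply/esym.
  apply: (forest_common_neighbours fG ab va vb); rewrite adj_sym //.
  by rewrite ff // -E -ff.
have fva : adj (f v) (f a) by rewrite -ff.
have fvb : adj (f v) (f b) by rewrite -ff.
have [q fv] := spine_of_two_neighbours fva fvb fab.
(* a vertex with the colour of [v] is adjacent to [a] and [b], as [v] is *)
have f_v u : u != l -> (f u == inl q) = (u == v).
  move=> ul; apply/eqP/eqP => [fu|->//].
  by apply: (forest_common_neighbours fG ab _ _ va vb); rewrite ff // fu -fv.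
have leafE u : u != l -> adj u l = adj (f u) (inr q).
  move=> ul; transitivity (f u == inl q); last by case: (f u).
  rewrite f_v //; apply/idP/eqP => [|-> //].
  by rewrite adj_sym => /leaf_l.
case: (minG) => [ncol _]; case: ncol.
exists (fun u => if u == l then inr q else f u) => u w.
case: eqVneq => [->|ul]; case: eqVneq => [->|wl].
- by rewrite adj_irrefl.
- by rewrite adj_sym leafE // adj_sym.
- exact: leafE.
exact: ff.
Qed.

(** An extra edge between the seven vertices would close a cycle of length 3, 4
    or 5 through [v]. *)
Lemma T2_model_embeds (G : sgraph) (v : G) :
  forest G -> 2 < #|adj v| ->
  (forall c, adj v c -> exists2 w, adj c w & w != v) ->
  exists f : T2_model -> G, injective f /\ full_hom f.
Proof.
move=> fG deg3 ext.
pose c (i : 'I_3) : G := enum_val (widen_ord deg3 i).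
have injc : injective c by move=> i j /enum_val_inj[/val_inj].
have vc i : adj v (c i) := enum_valP (widen_ord deg3 i).
have cv i : adj (c i) v by rewrite adj_sym.
have /fin_all_exists[d cdv] : forall i, exists w, adj (c i) w /\ w != v.
  by move=> i; have [w cw wv] := ext _ (vc i); exists w.
have cd i : adj (c i) (d i) by case: (cdv i).
have dc i : adj (d i) (c i) by rewrite adj_sym.
have dv i : d i != v by case: (cdv i).
pose f (x : T2_model) := match x with
  | None => v | Some (i, b) => if b then d i else c i end.
have Nvd i : adj v (d i) = false.
  by apply/negP => vd; apply: forest_no_triangle fG vd (dc i) (cv i).
have Ncc i j : adj (c i) (c j) = false.
  by apply/negP => cc; apply: forest_no_triangle fG cc (cv j) (vc i).
have cdE i j : adj (c i) (d j) = (i == j).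
  apply/idP/eqP => [cidj|<- //]; apply/eqP; case: eqVneq => // ij.
  case/eqP: (dv j); apply/esym.
  apply: (forest_common_neighbours (a := c i) (b := c j) fG) => //.
    by rewrite (inj_eq injc).
  by rewrite adj_sym.
have Ndd i j : adj (d i) (d j) = false.
  apply/negP => dd.
  exact: forest_no_pentagon fG (vc i) (cd i) dd (dc j) (cv j).
have ff : full_hom f.
  move=> [[i []]|] [[j []]|] //=; rewrite ?andbT ?andbF ?adj_irrefl //.
  - by rewrite adj_sym cdE eq_sym.
  - by rewrite adj_sym Nvd.
  - by rewrite cv.
  - by rewrite vc.
by exists f; split=> //; apply: full_hom_inj T2_model_twin_free ff.
Qed.

Lemma obstruction_contains_T2_model (k : nat) (G : sgraph) (v : G) :
  minimal_obstruction (centipede k) G -> forest G -> 2 < #|adj v| ->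
  exists f : T2_model -> G, injective f /\ full_hom f.
Proof.
move=> minG fG deg3; apply: (T2_model_embeds fG deg3) => c vc.
apply/exists_inP; rewrite -negb_forall_in; apply/negP => /forall_inP leaf_c.
move: deg3; rewrite ltnNge (leaf_neighbour_max_degree2 minG fG vc) // => w cw.
by apply/eqP/leaf_c.
Qed.

Theorem proposition13 (k : nat) (hk : 0 < k) :
  (k < 5 ->
     forall G : sgraph,
       minimal_obstruction (centipede k) G -> forest G -> linear_forest G) /\
  (5 <= k ->
     (minimal_obstruction (centipede k) T2 /\ forest T2 /\ ~ linear_forest T2) /\
     forall G : sgraph,
       minimal_obstruction (centipede k) G -> forest G -> ~ linear_forest G ->
       isomorphic G T2).
Proof.
split=> [k5 G minG fG|k5].
  apply: (linear_forest_of_max_degree2 fG) => v; rewrite leqNgt; apply/negP.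
  move=> /(obstruction_contains_T2_model minG fG)[f [injf ff]].
  (* [G] minus the centre of the copy of [T2] contains its three legs *)
  have fN x : x != None -> f x != f None by rewrite (inj_eq injf).
  have [|g fg] := @colouring_off _ _ (f None) (f (knee ord0)) minG.
    by rewrite eq_sym fN.
  apply: (@three_edges_not_colourable k (g \o f) k5) => u w uN wN.
  by rewrite ff fg // fN.
have [t [bij_t ft]] := T2_model_isomorphic; case: (bij_t) => t' tK t'K.
have ft' : full_hom t' by move=> x y; rewrite ft !t'K.
split=> [|G minG fG nlinG].
  split; last split.
  - split=> [[h fh]|A /properP[_ [y _ yA]]].
      exact: (@T2_model_not_colourable k) (ex_intro _ _ (full_hom_comp fh ft)).
    have [h fh] := T2_model_colourable_off (t' y) k5.
    exists (fun u : induced A => h (t' (val u))) => u v.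
    have off (w : induced A) : t' (val w) != t' y.
      by rewrite (can_eq t'K); apply: contraNneq yA => <-; apply: valP w.
    by rewrite -fh // -ft'.
  - exact: forest_embedding (can_inj t'K) ft' T2_model_forest.
  apply: (@claw_not_linear T2 (t None) (fun i => t (knee i))) => [i j|i].
    by move/(can_inj tK) => [].
  by rewrite -ft.
have [v deg3] : exists v : G, 2 < #|adj v|.
  apply/existsP; apply: contraT; rewrite negb_exists => /forallP deg2.
  case: nlinG; apply: (linear_forest_of_max_degree2 fG) => v.
  by rewrite leqNgt.
have [f [injf ff]] := obstruction_contains_T2_model minG fG deg3.
have surjf y : exists x, f x = y.
  exact: obstruction_onto (@T2_model_not_colourable k) minG ff None.
have [f' fK f'K] := inj_surj_bij injf surjf.
exists (t \o f'); first by apply: bij_comp bij_t _; exists f.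
by move=> x y; rewrite -ft ff !f'K.
Qed.
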